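(* Let $H$ be an $N$-dimensional Hilbert space, $N\in\mathbb N$, and let $M\in\mathbb N$. (i) Let $(x_n)_{n=1}^N$ be a basis of $H$ and let $T=(t_{ij})$ be an $N\times M$ matrix with the property that each square submatrix of $T$ is invertible. Define $x_{N+1},x_{N+2},\ldots,x_{N+M}\in H$ by $$x_{N+j}=\sum_{i=1}^Nt_{ij}x_i,\qquad \forall j=1,2,\ldots,M.$$ Then $(x_n)_{n=1}^{N+M}$ is a full spark frame for $H$. (ii) Conversely, if $(x_n)_{n=1}^{N+M}$ is a full spark frame for $H$, then there is an $N\times M$ matrix $T=(t_{ij})$, all of whose square submatrices are invertible, such that $x_{N+j}=\sum_{i=1}^Nt_{ij}x_i$ for all $j=1,2,\ldots,M$.
   Context: Matrices have complex entries. A square submatrix of $T$ is a matrix $(t_{ij})_{i\in I,j\in J'}$ with $I\subseteq\{1,\ldots,N\}$, $J'\subseteq\{1,\ldots,M\}$ nonempty and of equal cardinality (not necessarily consisting of consecutive indices). A finite sequence $(x_n)_{n=1}^{N+M}$ in an $N$-dimensional Hilbert space $H$ is a frame for $H$ iff it spans $H$; it is a full spark frame if it is a frame of uniform excess $M$, i.e. it becomes a basis for $H$ whenever any $M$ of its members are removed (equivalently, any $N$ of its members make up a basis for $H$). *)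

(* Defs.v *)
From HB Require Import structures.
From mathcomp Require Import all_boot all_order all_algebra.
From mathcomp Require Import sesquilinear.
From mathcomp Require Import reals complex.

Set Implicit Arguments.
Unset Strict Implicit.
Unset Printing Implicit Defensive.

Import Order.TTheory GRing.Theory Num.Theory.

Local Open Scope ring_scope.
Local Open Scope complex_scope.

(* A finite-dimensional complex Hilbert space is a vectType over R[i] together
   with a Hermitian positive definite form [ip], linear in its first argument;
   completeness is automatic in finite dimension. *)

(* In the order of R[i], [0 < A] says that A is real and positive, so the frame
   bounds A and B are real numbers. *)
Definition is_frame (R : realType) (H : vectType R[i])
    (ip : {dot H for (@Num.conj R[i])}) (n : nat) (x : 'I_n -> H) : Prop :=
  exists A B : R[i], [/\ 0 < A, 0 < B &
    forall v : H,
      A * ip v v <= \sum_(k < n) `|ip v (x k)| ^+ 2 <= B * ip v v].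

Definition uniform_excess (R : realType) (H : vectType R[i]) (n M : nat)
    (x : 'I_n -> H) : Prop :=
  forall J : {set 'I_n}, #|J| = M -> basis_of fullv [seq x k | k in ~: J].

Definition full_spark_frame (R : realType) (H : vectType R[i])
    (ip : {dot H for (@Num.conj R[i])}) (N M : nat) (x : 'I_(N + M) -> H)
    : Prop :=
  is_frame ip x /\ uniform_excess M x.

(* [enum_val] lists the elements of a set of ordinals in increasing order, so
   the matrix below is (t_ij) for i in I and j in J. *)
Definition square_submatrices_invertible (K : fieldType) (N M : nat)
    (T : 'M[K]_(N, M)) : Prop :=
  forall (I : {set 'I_N}) (J : {set 'I_M}) (eqIJ : #|I| = #|J|), I != set0 ->
    (\matrix_(a < #|I|, b < #|I|)
       T (enum_val a) (enum_val (cast_ord eqIJ b))) \in unitmx.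

(* Main.v *)
Require Import Defs.
From HB Require Import structures.
From mathcomp Require Import all_boot all_order all_algebra.
From mathcomp Require Import sesquilinear.
From mathcomp Require Import reals complex.
Import Order.TTheory GRing.Theory Num.Theory.
Local Open Scope ring_scope.
Local Open Scope complex_scope.

(* Removing M of the N + M vectors discards the basis vectors indexed by some
   set A and keeps the new vectors indexed by some set B with #|A| = #|B|; the
   remaining family is a basis iff the submatrix T[A, B] is invertible, and every
   pair (A, B) with #|A| = #|B| arises in this way. *)

(** Transports [freeP] along [enum_val]: coefficients are indexed by [I] itself, so later sums run
    over [k in A] and not over list positions. *)
Lemma free_imageP {K : fieldType} {V : vectType K} {I : finType} {A : {pred I}}
    {x : I -> V} :
  reflect (forall c : I -> K, \sum_(k in A) c k *: x k = 0 ->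
             {in A, forall k, c k = 0})
          (free [seq x k | k in A]).
Proof.
apply: (iffP (@freeP _ _ _ (image_tuple x A))) => freeA c.
- rewrite big_enum_val => sum0 k kA.
  rewrite -(enum_rankK_in kA kA).
  apply: (freeA (fun i => c (enum_val i))).
  by rewrite -[RHS]sum0; apply: eq_bigr => i _; rewrite nth_image.
- move=> sum0 i.
  have := freeA (fun k => c (enum_rank_in (enum_valP i) k)).
  rewrite big_enum_val => /(_ _ (enum_val i) (enum_valP i)).
  rewrite enum_valK_in; apply.
  rewrite -[RHS]sum0; apply: eq_bigr => j _.
  by rewrite enum_valK_in nth_image.
Qed.

(** A square matrix is invertible iff its kernel is trivial. The vector [d] lives on all of ['I_M],
    only its entries in [B] being relevant, which keeps enumerations out of later arguments. *)
Lemma submatrix_unitP {K : fieldType} {N M : nat} {T : 'M[K]_(N, M)}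
    {A : {set 'I_N}} {B : {set 'I_M}} {eqAB : #|A| = #|B|} :
  reflect (forall d : 'I_M -> K,
             {in A, forall i, \sum_(j in B) T i j * d j = 0} ->
             {in B, forall j, d j = 0})
    ((\matrix_(a < #|A|, b < #|A|)
        T (enum_val a) (enum_val (cast_ord eqAB b))) \in unitmx).
Proof.
have sumB (F : 'I_M -> K) :
    \sum_(j in B) F j = \sum_(a < #|A|) F (enum_val (cast_ord eqAB a)).
  rewrite big_enum_val; apply: reindex.
  by exists (cast_ord (esym eqAB)) => b _; rewrite ?cast_ordK ?cast_ordKV.
(* [row_free] concerns row vectors multiplied from the left, hence the transpose. *)
set S := \matrix_(a, b) _; rewrite -unitmx_tr -row_free_unit.
apply: (iffP idP) => [Sfree d d0 j jB | kerS].
- pose v := \row_(b < #|A|) d (enum_val (cast_ord eqAB b)).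
  have vS : v *m S^T = 0.
    apply/rowP => a; rewrite !mxE -[RHS](d0 _ (enum_valP a)) sumB.
    by apply: eq_bigr => b _; rewrite !mxE mulrC.
  have /rowP/(_ (cast_ord (esym eqAB) (enum_rank_in jB j))) : v = 0.
    by apply: (row_free_inj Sfree); rewrite mul0mx.
  by rewrite !mxE cast_ordKV enum_rankK_in.
- apply: inj_row_free => v vS; apply/rowP => a.
  pose jB := enum_valP (cast_ord eqAB a).
  (* Extends [v] arbitrarily outside [B]; here [jB] serves as the witness that [B] is nonempty. *)
  pose d j := v 0 (cast_ord (esym eqAB) (enum_rank_in jB j)).
  have dE b : d (enum_val (cast_ord eqAB b)) = v 0 b.
    by rewrite /d enum_valK_in cast_ordK.
  rewrite mxE -dE; apply: (kerS d) (jB) => i iA.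
  have /rowP/(_ (enum_rank_in iA i)) := vS.
  rewrite !mxE => vSi; rewrite -[RHS]vSi sumB.
  by apply: eq_bigr => b _; rewrite !mxE dE mulrC enum_rankK_in.
Qed.

Lemma card_split_ord {N M : nat} (J : {set 'I_(N + M)}) :
  #|J| = (#|[set i | lshift M i \in J]| + #|[set j | rshift N j \in J]|)%N.
Proof.
rewrite -!sum1_card big_split_ord /=.
by congr (_ + _)%N; apply: eq_bigl => i; rewrite inE.
Qed.

(* A vanishing combination of the selected vectors has its coefficients outside
   [A] determined by those in [B], and the latter lie in the kernel of the
   submatrix. *)
Lemma free_exchange {K : fieldType} {V : vectType K} {N M : nat}
    {x : 'I_(N + M) -> V} {T : 'M[K]_(N, M)} (L : {set 'I_(N + M)})
    {A : {set 'I_N}} {B : {set 'I_M}} (eqAB : #|A| = #|B|) :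
  free [seq x (lshift M i) | i : 'I_N] ->
  (forall j, x (rshift N j) = \sum_(i < N) T i j *: x (lshift M i)) ->
  (forall i, (lshift M i \in L) = (i \notin A)) ->
  (forall j, (rshift N j \in L) = (j \in B)) ->
  free [seq x k | k in L] =
  ((\matrix_(a < #|A|, b < #|A|)
      T (enum_val a) (enum_val (cast_ord eqAB b))) \in unitmx).
Proof.
move=> /free_imageP xfree xr Ll Lr.
have sumE c : \sum_(k in L) c k *: x k =
    \sum_(i < N) ((if i \in A then 0 else c (lshift M i)) +
      \sum_(j in B) T i j * c (rshift N j)) *: x (lshift M i).
  rewrite big_split_ord /= (eq_bigl _ _ Ll) (eq_bigl _ _ Lr).
  under [RHS]eq_bigr do rewrite scalerDl scaler_suml.
  rewrite big_split /= exchange_big /=; congr (_ + _).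
    rewrite big_mkcond /=; apply: eq_bigr => i _.
    by case: (i \in A); rewrite ?scale0r.
  apply: eq_bigr => j _; rewrite xr scaler_sumr.
  by apply: eq_bigr => i _; rewrite scalerA mulrC.
apply/free_imageP/submatrix_unitP => [freeL d d0 j jB | kerT c].
(* The old coefficients outside [A] cancel the contribution of [d]; at indices in [A] that
   contribution is already zero. *)
- pose c k := match split k with
    | inl i => - \sum_(j in B) T i j * d j
    | inr j => d j end.
  have cr j' : c (rshift N j') = d j' by rewrite /c (unsplitK (inr _ j')).
  have cl i : c (lshift M i) = - \sum_(j in B) T i j * d j.
    by rewrite /c (unsplitK (inl _ i)).
  rewrite -cr; apply: freeL; last by rewrite Lr.
  rewrite sumE big1 // => i _.
  under eq_bigr do rewrite cr.
  rewrite cl.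
  by case: ifP => [/d0 -> | _]; rewrite ?addr0 ?addNr scale0r.
(* Rows in [A] give the kernel condition, so the coefficients on [B] vanish; rows outside [A] then
   kill the remaining ones. *)
- rewrite sumE => /xfree coef0.
  have cB : {in B, forall j, c (rshift N j) = 0}.
    by apply: kerT => i iA; have := coef0 i isT; rewrite iA add0r.
  move=> k; rewrite -(splitK k); case: (split k) => [i | j] /=; last first.
    by rewrite Lr => /cB.
  rewrite Ll => /negPf iA; have := coef0 i isT; rewrite iA => <-.
  by rewrite big1 ?addr0 // => j /cB ->; rewrite mulr0.
Qed.

(* If the [x k] separate points, [v |-> (ip v (x k))_k] has a linear left
   inverse, i.e. there is a dual family [y] with [v = \sum_k ip v (x k) *: y k];
   Cauchy-Schwarz for [x] gives the upper bound and for [y] the lower one. *)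
Lemma separating_frame {R : realType} {H : vectType R[i]}
    (ip : {dot H for (@Num.conj R[i])}) {n : nat} (x : 'I_n -> H) :
  (forall v, (forall k, ip v (x k) = 0) -> v = 0) -> is_frame ip x.
Proof.
move=> sep.
pose f (v : H) : 'rV[R[i]]_n := \row_k ip v (x k).
have f_lin : linear f.
  by move=> a u v; apply/rowP => k; rewrite !mxE linearPl.
pose fL := GRing.isLinear.Build _ _ _ _ f f_lin.
pose F : {linear H -> 'rV[R[i]]_n} := HB.pack f fL.
pose g := linfun F.
have gE v : g v = f v by rewrite lfunE.
have kerg : lker g == 0%VS.
  apply/lker0P => u v; rewrite !gE => fuv.
  apply/eqP; rewrite -subr_eq0; apply/eqP/sep => k.
  have /rowP/(_ k) := fuv; rewrite !mxE linearBl /= => ->.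
  exact: subrr.
pose y k := (g^-1)%VF (delta_mx 0 k).
have expand v : v = \sum_k ip v (x k) *: y k.
  rewrite -{1}(lker0_lfunK kerg v) gE [f v]row_sum_delta linear_sum.
  by apply: eq_bigr => k _; rewrite linearZ mxE.
have sumD_ge0 (z : 'I_n -> H) : 0 <= \sum_k ip (z k) (z k).
  by apply: sumr_ge0 => k _; exact: dnorm_ge0.
(* The added 1 keeps the constant positive even if every [z k] is zero. *)
have sumD_gt0 (z : 'I_n -> H) : 0 < 1 + \sum_k ip (z k) (z k).
  by rewrite ltr_wpDr.
have sumCS (z : 'I_n -> H) v :
    \sum_k `|ip v (z k)| ^+ 2 <= (1 + \sum_k ip (z k) (z k)) * ip v v.
  rewrite mulrDl mul1r ler_wpDl ?dnorm_ge0 // mulr_suml.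
  by apply: ler_sum => k _; rewrite mulrC; exact: CauchySchwarz.
pose C := 1 + \sum_k ip (y k) (y k).
have C0 : 0 < C by exact: sumD_gt0.
exists C^-1, (1 + \sum_k ip (x k) (x k)).
split; rewrite ?invr_gt0 ?sumD_gt0 // => v.
apply/andP; split; last exact: sumCS.
set S := \sum_k _.
rewrite mulrC ler_pdivrMr // mulrC.
have t_le : ip v v <= \sum_k `|ip v (x k)| * `|ip v (y k)|.
  rewrite -[leLHS](ger0_norm (dnorm_ge0 ip v)) {2}[v]expand linear_sumr.
  apply: le_trans (ler_norm_sum _ _ _) _; apply: ler_sum => k _.
  by rewrite linearZr_LR /= normrM norm_conjC.
(* AM-GM: [2 C p q <= (C p)^2 + q^2] *)
have amgm k : C * (`|ip v (x k)| * `|ip v (y k)|) *+ 2 <=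
    C ^+ 2 * `|ip v (x k)| ^+ 2 + `|ip v (y k)| ^+ 2.
  rewrite -subr_ge0 -exprMn mulrA addrAC -sqrrB real_exprn_even_ge0 //.
  by rewrite realB // ger0_real // mulr_ge0 // ltW.
(* Sum the AM-GM bounds; Cauchy-Schwarz for [y] produces a term [C * ip v v] that cancels one of the
   two copies on the left. *)
have : C * ip v v *+ 2 <= C ^+ 2 * S + C * ip v v.
  apply: (@le_trans _ _ (\sum_k C * (`|ip v (x k)| * `|ip v (y k)|) *+ 2)).
    by rewrite sumrMnl -mulr_sumr lerMn2r ler_pM2l.
  apply: (le_trans (ler_sum _ (fun k _ => amgm k))).
  by rewrite big_split /= -mulr_sumr lerD2l; exact: sumCS.
by rewrite mulr2n lerD2r expr2 -mulrA ler_pM2l.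
Qed.

(** A vector orthogonal to a spanning family is orthogonal to itself, hence zero. *)
Lemma spanning_frame {R : realType} {H : vectType R[i]}
    (ip : {dot H for (@Num.conj R[i])}) {n : nat} (x : 'I_n -> H) :
  (forall v, exists c : 'I_n -> R[i], v = \sum_k c k *: x k) -> is_frame ip x.
Proof.
move=> span; apply: separating_frame => v orth.
apply/eqP; rewrite -(dnorm_eq0 ip).
have [c vE] := span v; rewrite {2}vE linear_sumr big1 // => k _.
by rewrite linearZr_LR /= orth mulr0.
Qed.

Lemma basis_image_expansion {K : fieldType} {V : vectType K} {I : finType}
    {x : I -> V} :
  basis_of fullv [seq x i | i : I] ->
  forall v, exists c : I -> K, v = \sum_i c i *: x i.
Proof.
move=> xbasis v.
exists (fun i => coord (image_tuple x I) (enum_rank i) v).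
have /= {1}-> := @coord_basis _ _ _ _ (image_tuple x I) v xbasis (memvf v).
rewrite [RHS](reindex _ (onW_bij _ (@enum_val_bij I))) /=.
by apply: eq_bigr => i _; rewrite enum_valK nth_image.
Qed.

Theorem theorem4p9 (R : realType) (N M : nat) (H : vectType R[i])
    (ip : {dot H for (@Num.conj R[i])}) (dimH : \dim {: H} = N) :
  (forall (x : 'I_(N + M) -> H) (T : 'M[R[i]]_(N, M)),
      basis_of fullv [seq x (lshift M i) | i : 'I_N] ->
      square_submatrices_invertible T ->
      (forall j : 'I_M,
         x (rshift N j) = \sum_(i < N) T i j *: x (lshift M i)) ->
      full_spark_frame ip x)
  /\
  (forall x : 'I_(N + M) -> H,
      full_spark_frame ip x ->
      exists T : 'M[R[i]]_(N, M),
        square_submatrices_invertible T /\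
        forall j : 'I_M,
          x (rshift N j) = \sum_(i < N) T i j *: x (lshift M i)).
Proof.
split=> [x T xbasis Tinv xr | x [_ xexcess]].
- split.
    apply: spanning_frame => v; have [c ->] := basis_image_expansion xbasis v.
    exists (fun k => if split k is inl i then c i else 0).
    rewrite big_split_ord /= [X in _ + X]big1 ?addr0.
      by apply: eq_bigr => i _; rewrite (unsplitK (inl _ i)).
    by move=> j _; rewrite (unsplitK (inr _ j)) scale0r.
  move=> J cardJ.
  (* Exactly N vectors remain, so only freeness is left to prove. *)
  rewrite basisEfree subvf dimH size_image cardsCs setCK card_ord cardJ addnK.
  rewrite leqnn !andbT.
  pose A := [set i | lshift M i \in J]; pose B := [set j | rshift N j \notin J].
  (* The removed set has [#|A|] old and [M - #|B|] new indices, [M] in all. *)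
  have eqAB : #|A| = #|B|.
    have := card_split_ord J; rewrite cardJ -/A.
    have -> : [set j | rshift N j \in J] = ~: B.
      by apply/setP => j; rewrite !inE negbK.
    have := cardsC B; rewrite card_ord => {1}<- /eqP.
    by rewrite eqn_add2r => /eqP.
  rewrite (free_exchange (~: J) eqAB (basis_free xbasis) xr).
  (* The hypothesis on [T] covers nonempty submatrices; the empty one is invertible by the kernel
     criterion. *)
  + have [A0 | An0] := eqVneq A set0; last exact: Tinv.
    apply/submatrix_unitP => d _ j; rewrite (_ : B = set0) ?inE //.
    by apply/eqP; rewrite -cards_eq0 -eqAB A0 cards0.
  + by move=> i; rewrite !inE.
  + by move=> j; rewrite !inE.
- have xbasis : basis_of fullv [seq x (lshift M i) | i : 'I_N].
    (* Removing all the new vectors leaves the first N, which thus form a basis. *)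
    pose J := [set rshift N j | j : 'I_M].
    have cardJ : #|J| = M by rewrite card_imset ?card_ord //; exact: rshift_inj.
    have /andP[/eqP spanx _] := xexcess J cardJ.
    rewrite basisEdim size_image card_ord dimH leqnn andbT -spanx.
    apply/sub_span => _ /imageP[k kJ ->]; move: kJ; rewrite -(splitK k).
    case: (split k) => [i | j] /=; first by rewrite image_f.
    by rewrite inE imset_f.
  have /fin_all_exists [t tE] j := basis_image_expansion xbasis (x (rshift N j)).
  pose T := \matrix_(i < N, j < M) t j i.
  have xr j : x (rshift N j) = \sum_(i < N) T i j *: x (lshift M i).
    by rewrite {1}tE; apply: eq_bigr => i _; rewrite mxE.
  exists T; split=> // I J eqIJ _.
  pose L := [set k | match split k with
                     | inl i => i \notin I | inr j => j \in J end].
  have Ll i : (lshift M i \in L) = (i \notin I).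
    by rewrite inE (unsplitK (inl _ i)).
  have Lr j : (rshift N j \in L) = (j \in J).
    by rewrite inE (unsplitK (inr _ j)).
  rewrite -(free_exchange L eqIJ (basis_free xbasis) xr Ll Lr) -[L]setCK.
  (* The complement of [L] has [#|I| + (M - #|J|) = M] elements. *)
  apply/basis_free/xexcess.
  rewrite card_split_ord -[RHS]card_ord -(cardsC J) -eqIJ.
  congr (_ + _)%N; apply: eq_card => k; first by rewrite inE in_setC Ll negbK.
  by rewrite inE !in_setC Lr.
Qed.
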